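(* There exists a monotonic sequence $\mathcal{T}=(T_1^{(k)},T_2^{(k)})_{k\geq 0}$ of pairs of $2\times 2$ contingency tables such that the following holds. 1. $(T_1^{(k)},T_2^{(k)})$ is an instance of positive SP for $k=0,4,8,\ldots$ (all $k\equiv 0 \pmod 4$). 2. $(T_1^{(k)},T_2^{(k)})$ is an instance of positive alignment for $k=1,5,9,\ldots$ (all $k\equiv 1\pmod 4$). 3. $(T_1^{(k)},T_2^{(k)})$ is an instance of negative SP for $k=2,6,10,\ldots$ (all $k\equiv 2\pmod 4$). 4. $(T_1^{(k)},T_2^{(k)})$ is an instance of negative alignment for $k=3,7,11,\ldots$ (all $k\equiv 3\pmod 4$).
   Context: A $2\times 2$ contingency table has entries that are positive real numbers. For two such tables $T_i=\begin{pmatrix} a_i & b_i\\ c_i& d_i\end{pmatrix}$, $i=1,2$, put $A_i=\frac{a_i}{a_i+b_i}$, $C_i=\frac{c_i}{c_i+d_i}$, and $\mu=\frac{a_1+a_2}{a_1+b_1+a_2+b_2}$, $\nu=\frac{c_1+c_2}{c_1+d_1+c_2+d_2}$. The pair $(T_1,T_2)$ is an instance of: - positive SP (Simpson's paradox) if $A_1>C_1$, $A_2>C_2$ and $\mu<\nu$; - negative SP if $A_1<C_1$, $A_2<C_2$ and $\mu>\nu$; - positive alignment if $A_1>C_1$, $A_2>C_2$ and $\mu>\nu$; - negative alignment if $A_1<C_1$, $A_2<C_2$ and $\mu<\nu$. A sequence $(T_1^{(k)},T_2^{(k)})_{k\ge 0}$ of pairs of $2\times 2$ contingency tables $T_i^{(k)}=\begin{pmatrix}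 a_i^{(k)} & b_i^{(k)}\\ c_i^{(k)}& d_i^{(k)}\end{pmatrix}$ is monotonic if for all $k\ge 0$ and $i=1,2$: $a_i^{(k+1)}\ge a_i^{(k)}$, $b_i^{(k+1)}\ge b_i^{(k)}$, $c_i^{(k+1)}\ge c_i^{(k)}$ and $d_i^{(k+1)}\ge d_i^{(k)}$. *)

(* Defs.v *)
From Stdlib Require Import Reals.
Open Scope R_scope.

(* The table  ( a b )
              ( c d )  with positive real entries. *)
Record table : Type := Table {
  ent_a : R; ent_b : R;
  ent_c : R; ent_d : R;
  ent_a_pos : 0 < ent_a; ent_b_pos : 0 < ent_b;
  ent_c_pos : 0 < ent_c; ent_d_pos : 0 < ent_d
}.

Definition rate_A (T : table) : R := ent_a T / (ent_a T + ent_b T).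
Definition rate_C (T : table) : R := ent_c T / (ent_c T + ent_d T).

Definition mu (T1 T2 : table) : R :=
  (ent_a T1 + ent_a T2) / (ent_a T1 + ent_b T1 + ent_a T2 + ent_b T2).
Definition nu (T1 T2 : table) : R :=
  (ent_c T1 + ent_c T2) / (ent_c T1 + ent_d T1 + ent_c T2 + ent_d T2).

Definition positive_SP (T1 T2 : table) : Prop :=
  rate_A T1 > rate_C T1 /\ rate_A T2 > rate_C T2 /\ mu T1 T2 < nu T1 T2.

Definition negative_SP (T1 T2 : table) : Prop :=
  rate_A T1 < rate_C T1 /\ rate_A T2 < rate_C T2 /\ mu T1 T2 > nu T1 T2.

Definition positive_alignment (T1 T2 : table) : Prop :=
  rate_A T1 > rate_C T1 /\ rate_A T2 > rate_C T2 /\ mu T1 T2 > nu T1 T2.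

Definition negative_alignment (T1 T2 : table) : Prop :=
  rate_A T1 < rate_C T1 /\ rate_A T2 < rate_C T2 /\ mu T1 T2 < nu T1 T2.

Definition table_le (T T' : table) : Prop :=
  ent_a T' >= ent_a T /\ ent_b T' >= ent_b T /\
  ent_c T' >= ent_c T /\ ent_d T' >= ent_d T.

(* A sequence of pairs is given by its two component sequences. *)
Definition monotonic (T1 T2 : nat -> table) : Prop :=
  forall k : nat, table_le (T1 k) (T1 (S k)) /\ table_le (T2 k) (T2 (S k)).

(* Main.v *)
(** All four properties are invariant under multiplying both tables by the same
    positive factor. So it suffices to pick one pair of tables for each property,
    with all entries in [1, 6], and to scale the pair used at step [k] by [6 ^ k]:
    every entry is then at most [6 ^ k * 6], and the next one at least [6 ^ (k + 1)]. *)
Require Import Defs.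
From Stdlib Require Import Reals Lra.
Open Scope R_scope.

Definition scale (s : R) (s_pos : 0 < s) (T : table) : table :=
  {| ent_a := s * ent_a T; ent_b := s * ent_b T;
     ent_c := s * ent_c T; ent_d := s * ent_d T;
     ent_a_pos := Rmult_lt_0_compat _ _ s_pos (ent_a_pos T);
     ent_b_pos := Rmult_lt_0_compat _ _ s_pos (ent_b_pos T);
     ent_c_pos := Rmult_lt_0_compat _ _ s_pos (ent_c_pos T);
     ent_d_pos := Rmult_lt_0_compat _ _ s_pos (ent_d_pos T) |}.

(** Exchanges [rate_A] with [rate_C] and, applied to both tables, [mu] with [nu]; each positive
    pattern thus yields its negative counterpart. *)
Definition swap_rows (T : table) : table :=
  {| ent_a := ent_c T; ent_b := ent_d T; ent_c := ent_a T; ent_d := ent_b T;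
     ent_a_pos := ent_c_pos T; ent_b_pos := ent_d_pos T;
     ent_c_pos := ent_a_pos T; ent_d_pos := ent_b_pos T |}.

Lemma rate_A_scale (s : R) (s_pos : 0 < s) (T : table) :
  rate_A (scale s s_pos T) = rate_A T.
Proof. unfold rate_A; simpl; rewrite <- !Rmult_plus_distr_l; apply Rdiv_mult_l_l; lra. Qed.

Lemma rate_C_scale (s : R) (s_pos : 0 < s) (T : table) :
  rate_C (scale s s_pos T) = rate_C T.
Proof. unfold rate_C; simpl; rewrite <- !Rmult_plus_distr_l; apply Rdiv_mult_l_l; lra. Qed.

Lemma mu_scale (s : R) (s_pos : 0 < s) (T1 T2 : table) :
  mu (scale s s_pos T1) (scale s s_pos T2) = mu T1 T2.
Proof. unfold mu; simpl; rewrite <- !Rmult_plus_distr_l; apply Rdiv_mult_l_l; lra. Qed.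

Lemma nu_scale (s : R) (s_pos : 0 < s) (T1 T2 : table) :
  nu (scale s s_pos T1) (scale s s_pos T2) = nu T1 T2.
Proof. unfold nu; simpl; rewrite <- !Rmult_plus_distr_l; apply Rdiv_mult_l_l; lra. Qed.

Definition table_within (l u : R) (T : table) : Prop :=
  l <= ent_a T <= u /\ l <= ent_b T <= u /\
  l <= ent_c T <= u /\ l <= ent_d T <= u.

Lemma scale_le (s s' l u : R) (s_pos : 0 < s) (s'_pos : 0 < s') (T T' : table) :
  s * u <= s' * l -> table_within l u T -> table_within l u T' ->
  table_le (scale s s_pos T) (scale s' s'_pos T').
Proof.
  intros Hsu HT HT'.
  assert (Hle : forall x y, x <= u -> l <= y -> s' * y >= s * x).
  { intros x y Hx Hy.
    apply (Rmult_le_compat_l s) in Hx; [|lra].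
    apply (Rmult_le_compat_l s') in Hy; lra. }
  unfold table_within in *.
  repeat split; simpl; apply Hle; lra.
Qed.

(** With [simpson2], a Simpson reversal: 2/3 > 3/5 and 2/5 > 1/3, yet the pooled rates are 6/13 <
    7/13. *)
Definition simpson1 : table :=
  Table 2 1 6 4 ltac:(lra) ltac:(lra) ltac:(lra) ltac:(lra).
Definition simpson2 : table :=
  Table 4 6 1 2 ltac:(lra) ltac:(lra) ltac:(lra) ltac:(lra).
(** Serves as both tables of a pair, so pooling leaves the rates 2/3 and 1/3 unchanged. *)
Definition aligned : table :=
  Table 2 1 1 2 ltac:(lra) ltac:(lra) ltac:(lra) ltac:(lra).

(** Here [r] stands for [k mod 4], so the last branch is the residue 3. *)
Definition pattern1 (r : nat) : table :=
  match r with
  | 0 => simpson1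
  | 1 => aligned
  | 2 => swap_rows simpson1
  | _ => swap_rows aligned
  end.

Definition pattern2 (r : nat) : table :=
  match r with
  | 0 => simpson2
  | 1 => aligned
  | 2 => swap_rows simpson2
  | _ => swap_rows aligned
  end.

Lemma pattern1_within (r : nat) : table_within 1 6 (pattern1 r).
Proof. destruct r as [|[|[|r]]]; unfold table_within; simpl; lra. Qed.

Lemma pattern2_within (r : nat) : table_within 1 6 (pattern2 r).
Proof. destruct r as [|[|[|r]]]; unfold table_within; simpl; lra. Qed.

Lemma pow6_pos (k : nat) : 0 < 6 ^ k.
Proof. apply pow_lt; lra. Qed.

Theorem theorem10 :
  exists T1 T2 : nat -> table,
    monotonic T1 T2 /\
    (forall k : nat, (k mod 4 = 0)%nat -> positive_SP (T1 k) (T2 k)) /\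
    (forall k : nat, (k mod 4 = 1)%nat -> positive_alignment (T1 k) (T2 k)) /\
    (forall k : nat, (k mod 4 = 2)%nat -> negative_SP (T1 k) (T2 k)) /\
    (forall k : nat, (k mod 4 = 3)%nat -> negative_alignment (T1 k) (T2 k)).
Proof.
  exists (fun k => scale (6 ^ k) (pow6_pos k) (pattern1 (k mod 4))),
         (fun k => scale (6 ^ k) (pow6_pos k) (pattern2 (k mod 4))).
  split.
  (* The bound on the scales holds with equality: [6 ^ k * 6 = 6 ^ S k * 1]. *)
  { intro k; split; apply (scale_le _ _ 1 6);
      auto using pattern1_within, pattern2_within; simpl; lra. }
  (* The residue [H] selects a concrete pair and scale invariance removes [6 ^ k], leaving
     comparisons of numerical fractions. *)
  repeat split; try rewrite H;
    rewrite ?rate_A_scale, ?rate_C_scale, ?mu_scale, ?nu_scale;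
    unfold rate_A, rate_C, mu, nu; simpl; lra.
Qed.
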